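(* Let $G$ be a finite group with a unique nonlinear irreducible character $\phi$ and with $Z(G)=\{1\}$, and let $p^m$ be the prime power with $|G|=p^m(p^m-1)$ and $|G'|=p^m$. If $g\in G'$ and $n\ge 3$, then $$\zeta^{w_n}_G(g)=\begin{cases}\frac{|G|^n}{|G'|}+|G|\,C^{w_n}(\phi) & \text{if } g=1,\\[2pt] \frac{|G|^n}{|G'|}-\frac{|G|}{p^m-1}\,C^{w_n}(\phi) & \text{if } g\ne1.\end{cases}$$ In particular, for $n=3$, $$\zeta^{w_3}_G(g)=\begin{cases}\frac{2|G|^3}{|G'|}+\frac{|G|^2}{p^m-1}(p^m-2) & \text{if } g=1,\\[2pt] \frac{|G|^3}{|G'|}-\frac{|G|^2}{p^m-1}\left(\frac{|G|}{|G'|}+\frac{p^m-2}{p^m-1}\right) & \text{if } g\ne 1.\end{cases}$$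
   Context: $[a,b]=a^{-1}b^{-1}ab$; $w_2(x_1,x_2)=[x_1,x_2]$ and $w_n(x_1,\dots,x_n)=[w_{n-1}(x_1,\dots,x_{n-1}),x_n]$ for $n\ge 3$. $\zeta^{w_n}_G(g)=|\{(a_1,\dots,a_n)\in G^n: w_n(a_1,\dots,a_n)=g\}|$. For an irreducible complex character $\chi$ of $G$ and $n\ge 3$, $C^{w_n}(\chi)=\langle\zeta^{w_{n-1}}_G\chi,\chi\rangle$, where $\langle\alpha,\beta\rangle=\frac1{|G|}\sum_{g\in G}\alpha(g)\overline{\beta(g)}$. $G'=[G,G]$. By a known theorem (Berkovich–Chillag–Herzog), a finite group with a unique nonlinear irreducible character and trivial center is a Frobenius group of order $p^m(p^m-1)$ for some prime power $p^m$, with abelian Frobenius kernel $G'$ of order $p^m$ and cyclic Frobenius complement; this defines $p^m$. *)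

(* Defs.v *)
From HB Require Import structures.
From mathcomp Require Import all_boot all_order all_algebra all_fingroup.
From mathcomp Require Import all_solvable all_field all_character.

Set Implicit Arguments.
Unset Strict Implicit.
Unset Printing Implicit Defensive.

Import Order.TTheory GroupScope GRing.Theory Num.Theory.
Local Open Scope ring_scope.

(* wcomm [:: x1; ...; xn] = [~ x1, ..., xn], left-normed; on one letter it is x1.
   MathComp's [~ x, y] is x^-1 * x ^ y = x^-1 * y^-1 * x * y. *)
Definition wcomm (gT : finGroupType) (s : seq gT) : gT :=
  if s is x :: s' then foldl commg x s' else 1%g.

(* zeta^{w_n}_G(g) as a natural number. *)
Definition nsol (gT : finGroupType) (G : {group gT}) (n : nat) (g : gT) : nat :=
  #|[set a : n.-tuple gT | all [in G] a & wcomm a == g]|.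

Lemma w_in (gT : finGroupType) (G : {group gT}) (s : seq gT) :
  all [in G] s -> wcomm s \in G.
Proof.
case: s => [|x s] /=; first by rewrite group1.
case/andP; elim: s x => //= y s IHs x Gx /andP[Gy Gs].
by apply: IHs; rewrite ?groupR.
Qed.

Lemma w_conj (gT : finGroupType) (s : seq gT) (y : gT) :
  wcomm [seq x ^ y | x <- s]%g = (wcomm s ^ y)%g.
Proof.
case: s => [|x s] /=; first by rewrite conj1g.
by elim: s x => //= z s IHs x; rewrite -conjRg IHs.
Qed.

Lemma nsol_le_conj (gT : finGroupType) (G : {group gT}) n (g y : gT) :
  y \in G -> (nsol G n g <= nsol G n (g ^ y)%g)%N.
Proof.
move=> Gy; pose f (a : n.-tuple gT) := [tuple of [seq (x ^ y)%g | x <- a]].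
have f_inj : injective f.
  move=> a b /(congr1 val) /=; move/(inj_map (conjg_inj y)) => ab.
  exact: val_inj.
rewrite /nsol -(card_imset _ f_inj).
apply/subset_leq_card/subsetP => _ /imsetP[a + ->].
rewrite !inE => /andP[Ga /eqP wa]; apply/andP; split.
  by rewrite all_map (sub_all _ Ga) // => x Gx; rewrite /= groupJ.
by rewrite /= w_conj wa.
Qed.

Lemma zeta_subproof (gT : finGroupType) (G : {group gT}) (n : nat) :
  is_class_fun <<G>> [ffun g => (nsol G n g)%:R : algC].
Proof.
rewrite genGid; apply: intro_class_fun => [x y Gx Gy | x Gx].
  congr _%:R; apply/eqP; rewrite eqn_leq nsol_le_conj // andbT.
  by rewrite -{2}(conjgK y x) nsol_le_conj ?groupV.
rewrite /nsol (_ : finset _ = set0) ?cards0 //; apply/setP=> a; rewrite !inE.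
by apply: contraNF Gx => /andP[/w_in Gw /eqP <-].
Qed.

Definition zeta (gT : finGroupType) (G : {group gT}) (n : nat) : 'CF(G) :=
  Cfun 0 (zeta_subproof G n).

(* Meaningful for n >= 3; below that n.-1 is not the index of a commutator word. *)
Definition Cw (gT : finGroupType) (G : {group gT}) (n : nat) (chi : 'CF(G)) :
    algC :=
  '[zeta G n.-1 * chi, chi].

(* Main.v *)
(* Averaging 'chi_i over conjugates (Schur's lemma) turns the recursion
   w_(n+1) = [w_n, x] into '[zeta_(n+1), 'chi_i] = #|G| / 'chi_i(1) * Cw_(n+1)('chi_i),
   which determines zeta_(n+1).  Every linear character has value 1 on G' and
   contributes #|G|^n to zeta_(n+1) there.  The regular character forces phi(1) = q - 1
   and phi = -1 on G' \ 1, and phi vanishes off G' because lambda * phi = phi for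
   every linear character lambda.  With w_1(x) = x we have Cw_2(phi) = 1, so the
   formula at n = 2 gives zeta_2, and hence Cw_3(phi). *)

Require Import Defs.
From HB Require Import structures.
From mathcomp Require Import all_boot all_order all_algebra all_fingroup.
From mathcomp Require Import all_solvable all_field all_character.
From mathcomp Require Import ring.

Set Implicit Arguments.
Unset Strict Implicit.
Unset Printing Implicit Defensive.

Import Order.TTheory GroupScope GRing.Theory Num.Theory.
Local Open Scope ring_scope.

(** In a representation [rG] affording ['chi_i], the sum [A] of [rG (h ^ x)] over [G] commutes with
    [rG], hence is a scalar, and its trace determines that scalar. The formula is the trace of
    [rG g *m A]. *)
Lemma sum_irr_mulJ (gT : finGroupType) (G : {group gT}) (i : Iirr G) (g h : gT) :
    g \in G -> h \in G ->
  \sum_(x in G) 'chi_i (g * h ^ x)%g = #|G|%:R / 'chi_i 1%g * ('chi_i g * 'chi_i h).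
Proof.
move=> Gg Gh; have /irr_reprP[rG irrG chi_rG] := mem_irr i.
have chiE x : x \in G -> 'chi_i x = \tr (rG x).
  by move=> Gx; rewrite chi_rG cfunE Gx mulr1n.
pose A := \sum_(x in G) rG (h ^ x)%g.
have /is_scalar_mxP[c Ac] : is_scalar_mx A.
  apply: (mx_abs_irr_cent_scalar (groupC irrG)).
  apply/centgmxP=> y Gy; rewrite /A mulmx_suml mulmx_sumr.
  (* After replacing [x] by [x * y] on the right, summands match because
     [h ^ x * y = y * h ^ (x * y)]. *)
  rewrite [RHS](reindex_acts 'R _ Gy) ?astabsR //=; apply: eq_bigr => x Gx.
  by rewrite -!repr_mxM ?groupJ ?groupM // conjgM -conjgC.
have trA : \tr A = #|G|%:R * 'chi_i h.
  rewrite /A raddf_sum /= mulr_natl -sumr_const; apply: eq_bigr => x Gx.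
  by rewrite -chiE ?groupJ // cfunJ.
have cE : c = #|G|%:R / 'chi_i 1%g * 'chi_i h.
  have chi1 := irr1_neq0 i.
  move: trA; rewrite Ac mxtrace_scalar -[c *+ _]mulr_natr -(cfRepr1 rG) -chi_rG => trA.
  by apply: (mulIf chi1); rewrite trA mulrAC divfK.
transitivity (\tr (rG g *m A)).
  rewrite /A mulmx_sumr raddf_sum; apply: eq_bigr => x Gx /=.
  have Ghx : (h ^ x)%g \in G by rewrite groupJ.
  by rewrite chiE; [rewrite repr_mxM | rewrite groupM].
by rewrite Ac mul_mx_scalar mxtraceZ -chiE // cE mulrAC mulrA.
Qed.

(** Since [[~ h, x] = h^-1 * h ^ x], this is the previous sum with [g = h^-1]. *)
Lemma sum_irr_commg (gT : finGroupType) (G : {group gT}) (i : Iirr G) (h : gT) :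
    h \in G ->
  \sum_(x in G) 'chi_i [~ h, x] = #|G|%:R / 'chi_i 1%g * ('chi_i h * ('chi_i h)^*).
Proof.
move=> Gh; rewrite sum_irr_mulJ ?groupV // char_inv ?irr_char //.
by rewrite [_^* * _]mulrC.
Qed.

Lemma zeta_sum (gT : finGroupType) (G : {group gT}) (n : nat) (F : gT -> algC) :
  \sum_(g in G) zeta G n g * F g =
  \sum_(a : n.-tuple gT | all [in G] a) F (wcomm a).
Proof.
rewrite (partition_big (fun a : n.-tuple gT => wcomm a) [in G]) /=; last first.
  by move=> a; apply: w_in.
apply: eq_bigr => g Gg; rewrite cfunE /nsol mulr_natl -sumr_const.
by apply: eq_big => [a | a]; rewrite inE // => /andP[_ /eqP->].
Qed.

Lemma wcomm_rcons (gT : finGroupType) (s : seq gT) (x : gT) :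
  (0 < size s)%N -> wcomm (rcons s x) = [~ wcomm s, x]%g.
Proof. by case: s => // y s _; rewrite /= foldl_rcons. Qed.

(** Split each tuple into its first [n] letters and its last one. Positivity of [n] matters: on the
    empty prefix, appending [x] gives [x] and not [[~ 1, x]]. *)
Lemma zeta_sumS (gT : finGroupType) (G : {group gT}) (n : nat) (F : gT -> algC) :
    (0 < n)%N ->
  \sum_(g in G) zeta G n.+1 g * F g =
  \sum_(g in G) zeta G n g * \sum_(x in G) F [~ g, x]%g.
Proof.
move=> n_gt0; rewrite !zeta_sum.
pose f (bx : n.-tuple gT * gT) := [tuple of rcons bx.1 bx.2].
have f_bij : bijective f.
  apply: inj_card_bij; last by rewrite card_prod !card_tuple expnSr.
  move=> [b x] [c y] /(congr1 val)/= /rcons_inj[bc ->].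
  by congr (_, _); apply: val_inj.
rewrite (reindex f) /=; last exact: onW_bij.
rewrite pair_big_dep /=; apply: eq_big => [[b x] | [b x] _] /=.
  by rewrite all_rcons andbC.
by rewrite wcomm_rcons ?size_tuple.
Qed.

Lemma zeta1 (gT : finGroupType) (G : {group gT}) : zeta G 1 = 1.
Proof.
apply/cfun_inP=> g Gg; rewrite cfun1E Gg cfunE /nsol.
rewrite (_ : finset _ = [set [tuple g]]) ?cards1 //.
apply/setP=> a; rewrite !inE; case/tupleP: a => x a; rewrite tuple0 /=.
by rewrite -val_eqE /= eqseq_cons andbT; case: eqP => [->|]; rewrite ?Gg ?andbF.
Qed.

Lemma sum_zeta (gT : finGroupType) (G : {group gT}) (n : nat) :
  \sum_(g in G) zeta G n.+1 g = #|G|%:R ^+ n.+1.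
Proof.
elim: n => [|n IHn].
  rewrite zeta1 expr1 -sumr_const; apply: eq_bigr => g Gg.
  by rewrite cfun1E Gg.
under eq_bigr => g _ do rewrite -[zeta _ _ g]mulr1.
rewrite (zeta_sumS G (fun=> 1)) // -mulr_suml IHn.
by rewrite sumr_const -exprSr.
Qed.

(** Summing the conjugate of ['chi_i] over the last letter yields a real multiple of [|'chi_i|^2],
    which turns the sum into the inner product defining [Cw n.+1]. *)
Lemma cfdot_zetaS (gT : finGroupType) (G : {group gT}) (n : nat) (i : Iirr G) :
    (0 < n)%N ->
  '[zeta G n.+1, 'chi_i] = #|G|%:R / 'chi_i 1%g * Cw n.+1 'chi_i.
Proof.
move=> n_gt0; rewrite /Cw !cfdotE mulrCA; congr (_ * _).
rewrite (zeta_sumS G (fun g => ('chi_i g)^*)) // mulr_sumr.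
apply: eq_bigr => g Gg; rewrite -rmorph_sum /= sum_irr_commg // [(_ * 'chi_i) g]cfunE.
rewrite irr1_degree !rmorphM /= conjCK fmorphV /= !conjC_nat.
ring.
Qed.

(** As [|chi| = 1] on [G], this is the mean value of [zeta G n.+1]. *)
Lemma Cw_lin (gT : finGroupType) (G : {group gT}) (n : nat) (chi : 'CF(G)) :
  chi \is a linear_char -> Cw n.+2 chi = #|G|%:R ^+ n.
Proof.
move=> lin_chi; have oG0 : (#|G|%:R : algC) != 0 by rewrite neq0CG.
rewrite /Cw cfdotE; apply: (mulfI oG0); rewrite mulVKf // -exprS -sum_zeta.
apply: eq_bigr => g Gg; rewrite [(_ * chi) g]cfunE -mulrA -normCK normC_lin_char //.
by rewrite expr1n mulr1.
Qed.

Section UniqueNonlinear.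

Variables (gT : finGroupType) (G : {group gT}) (phi : 'CF(G)).
Hypotheses (phi_irr : phi \in irr G) (phi_nonlin : phi \isn't a linear_char).
Hypothesis phi_uniq : forall chi : 'CF(G),
  chi \in irr G -> chi \isn't a linear_char -> chi = phi.

Let oG : algC := #|G|%:R.
Let d : algC := #|G : G^`(1)%g|%:R.

(** The [d] linear characters are all 1 at [g]. The coefficient [a] is left general so as to serve
    both the regular character and [zeta]. *)
Lemma sum_unique_nonlinear (a : 'CF(G) -> algC) (g : gT) : g \in G^`(1)%g ->
    (forall chi, chi \is a linear_char -> a chi = a 1) ->
  \sum_i a 'chi_i * 'chi_i g = d * a 1 + a phi * phi g.
Proof.
have /irrP[k phiE] := phi_irr => G'g a_lin.
have linE i : ('chi_i \is a linear_char) = (i != k).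
  apply/idP/idP=> [lin_i | ik].
    by apply: contraNneq phi_nonlin => ik; rewrite phiE -ik.
  by apply: contraR ik => /(phi_uniq (mem_irr i)); rewrite phiE => /irr_inj->.
rewrite (bigD1 k) //= addrC -phiE; congr (_ + _).
rewrite (eq_bigr (fun=> a 1)) => [|i]; last first.
  rewrite -linE => lin_i; rewrite a_lin //.
  have := subsetP (lin_char_der1 lin_i) g G'g.
  rewrite cfkerEirr inE lin_char1 // => /eqP->; exact: mulr1.
rewrite sumr_const /d -card_lin_irr mulr_natl; congr (_ *+ _).
by apply: eq_card => i; rewrite !inE linE.
Qed.

Lemma unique_nonlinear_vanish (g : gT) :
  g \in G -> g \notin G^`(1)%g -> phi g = 0.
Proof.
move=> Gg; apply: contraNeq => phi_g; rewrite -cap_cfker_lin_irr.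
apply/bigcapP=> i lin_i; rewrite cfkerEirr inE lin_char1 //.
have E : 'chi_i * phi = phi.
  apply: phi_uniq; first exact: mul_lin_irr.
  (* Were the product linear, dividing by ['chi_i] would make [phi] linear. *)
  apply: contra phi_nonlin => lin_phi.
  by rewrite -[phi](mulKr (lin_char_unitr lin_i)) rpredM ?rpredV.
(* Cancelling [phi g != 0] puts [g] in the kernel of every linear character; these kernels meet in
   the derived subgroup. *)
by apply/eqP/(mulIf phi_g); rewrite mul1r -[in RHS]E cfunE.
Qed.

Lemma unique_nonlinear_values (g : gT) : g \in G^`(1)%g ->
  d + phi 1%g * phi g = oG *+ (g == 1%g).
Proof.
move=> G'g; rewrite -cfRegE cfReg_sum sum_cfunE.
under eq_bigr => i _ do rewrite cfunE.
rewrite (sum_unique_nonlinear (a := fun chi => chi 1%g)) // => [|chi lin_chi].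
  by rewrite cfun11 mulr1.
by rewrite lin_char1 ?cfun11.
Qed.

Lemma zetaS_unique_nonlinear (n : nat) (g : gT) : g \in G^`(1)%g ->
  zeta G n.+2 g = d * oG ^+ n.+1 + oG / phi 1%g * Cw n.+2 phi * phi g.
Proof.
move=> G'g; rewrite {1}[zeta _ _]cfun_sum_cfdot sum_cfunE.
under eq_bigr => i _ do rewrite cfunE cfdot_zetaS //.
pose a (chi : 'CF(G)) := oG / chi 1%g * Cw n.+2 chi.
have a_lin chi : chi \is a linear_char -> a chi = oG ^+ n.+1.
  by move=> lin_chi; rewrite /a lin_char1 // divr1 Cw_lin // exprS.
rewrite (sum_unique_nonlinear (a := a)) // => [|chi lin_chi].
  by rewrite (a_lin 1) ?cfun1_lin_char.
by rewrite !a_lin ?cfun1_lin_char.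
Qed.

End UniqueNonlinear.

Theorem theorem3p20 (gT : finGroupType) (G : {group gT}) (phi : 'CF(G))
    (phi_irr : phi \in irr G)
    (phi_nonlin : phi \isn't a linear_char)
    (phi_uniq : forall chi : 'CF(G),
       chi \in irr G -> chi \isn't a linear_char -> chi = phi)
    (centerG : 'Z(G)%g = 1%g)
    (p m : nat) (p_prime : prime p)
    (cardG : #|G| = (p ^ m * (p ^ m - 1))%N)
    (cardG' : #|G^`(1)%g| = (p ^ m)%N)
    (g : gT) (G'g : g \in G^`(1)%g) :
  let oG : algC := #|G|%:R in
  let oG' : algC := #|G^`(1)%g|%:R in
  let q : algC := (p ^ m)%:R in
  (forall n : nat, (3 <= n)%N ->
     zeta G n g = if g == 1%g then oG ^+ n / oG' + oG * Cw n phi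
                  else oG ^+ n / oG' - oG / (q - 1) * Cw n phi)
  /\
  zeta G 3 g =
    if g == 1%g then 2%:R * oG ^+ 3 / oG' + oG ^+ 2 / (q - 1) * (q - 2%:R)
    else oG ^+ 3 / oG'
         - oG ^+ 2 / (q - 1) * (oG / oG' + (q - 2%:R) / (q - 1)).
Proof.
move=> oG oG' q; have pm_gt0 : (0 < p ^ m)%N by rewrite -cardG' cardG_gt0.
have index_G' : #|G : G^`(1)%g| = (p ^ m - 1)%N.
  apply/eqP; rewrite -(eqn_pmul2l pm_gt0) -cardG -cardG' Lagrange //.
  exact: der_sub.
have q1E : (p ^ m - 1)%:R = q - 1 :> algC by rewrite natrB.
have oGE : oG = q * (q - 1) by rewrite /oG cardG natrM q1E.
have oG'E : oG' = q by rewrite /oG' cardG'.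
have q0 : q != 0 by rewrite -oG'E neq0CG.
have q1 : q - 1 != 0.
  by have := neq0CG G; rewrite -/oG oGE mulf_eq0 negb_or => /andP[].
(* At the identity the regular character gives [phi(1)^2 = q(q - 1) - (q - 1) = (q - 1)^2]; both
   bases are nonnegative, so the squares may be dropped. *)
have phi1E : phi 1%g = q - 1.
  have := unique_nonlinear_values phi_irr phi_nonlin phi_uniq (group1 _).
  rewrite eqxx mulr1n index_G' q1E -/oG oGE => E.
  apply/eqP; rewrite -(@eqrXn2 _ 2) //; last first.
  - by rewrite -q1E ler0n.
  - by have /irrP[k ->] := phi_irr; rewrite ltW ?irr1_gt0.
  by apply/eqP/(addrI (q - 1)); rewrite expr2 E; ring.
have phiE h : h \in G^`(1)%g -> h != 1%g -> phi h = -1.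
  move=> G'h /negPf h1.
  have := unique_nonlinear_values phi_irr phi_nonlin phi_uniq G'h.
  rewrite h1 mulr0n index_G' q1E phi1E => E.
  by apply/(mulfI q1)/(addrI (q - 1)); rewrite E mulrN1 subrr.
(* Stated from length 2 on, and for every [h] in the derived subgroup, because computing [Cw 3 phi]
   needs all the values of [zeta G 2] there. *)
have zetaE n h : h \in G^`(1)%g -> zeta G n.+2 h =
    if h == 1%g then oG ^+ n.+2 / oG' + oG * Cw n.+2 phi
    else oG ^+ n.+2 / oG' - oG / (q - 1) * Cw n.+2 phi.
  move=> G'h; rewrite (zetaS_unique_nonlinear phi_irr phi_nonlin phi_uniq) //.
  have -> : oG ^+ n.+2 / oG' = (q - 1) * oG ^+ n.+1.
    by rewrite exprS {1}oGE oG'E; field.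
  rewrite index_G' q1E -/oG phi1E.
  by case: eqP => [-> | /eqP h1]; rewrite ?phi1E ?phiE //; field.
split; first by case=> [|[|n]] // _; apply: zetaE.
have Cw2 : Cw 2 phi = 1.
  by rewrite /Cw zeta1 mul1r; have /irrP[k ->] := phi_irr; rewrite cfnorm_irr.
have Cw3 : Cw 3 phi = oG * ((q - 1) + (q - 2%:R) / (q - 1)).
  (* The support of [phi] restricts the inner product to the derived subgroup: one term at the
     identity and [q - 1] equal terms elsewhere. *)
  have phi_on : phi \in 'CF(G, G^`(1)%g).
    apply/cfun_onP=> h G'h; have [Gh | /cfun0-> //] := boolP (h \in G).
    exact: (unique_nonlinear_vanish phi_irr phi_nonlin phi_uniq).
  rewrite /Cw (cfdotEr _ phi_on) (big_setD1 1%g) //=.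
  rewrite [(_ * phi) 1%g]cfunE (zetaE 0) // eqxx Cw2 phi1E.
  (* Away from the identity [phi] times its conjugate is 1, so the term is just [zeta G 2 h]. *)
  rewrite (eq_bigr (fun=> oG ^+ 2 / oG' - oG / (q - 1))) => [|h]; last first.
    case/setD1P=> h1 G'h; rewrite [(_ * phi) h]cfunE (zetaE 0) // (negPf h1).
    by rewrite Cw2 phiE // rmorphN1 mulr1 !mulrN1 opprK.
  have -> : (q - 1)^* = q - 1 by rewrite -q1E conjC_nat.
  rewrite sumr_const (_ : #|_| = p ^ m - 1)%N; last first.
    by rewrite -cardG' (cardsD1 1%g G^`(1)%g) group1 addKn.
  rewrite -[_ *+ (_ - _)]mulr_natr q1E -/oG oG'E oGE.
  by field; rewrite q0 q1.
rewrite zetaE // Cw3 oG'E oGE.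
by case: eqP => _; field; rewrite ?q0 ?q1.
Qed.
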